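(* Let $x$ be a $\mathrm{Bernoulli}(\theta)$ observation, and let $\pi(\theta)$ be the prior probability of $\theta$ for $\theta\in\Theta\subseteq[0,1]$. Let $\overline{\theta}:=\mathbb{E}[\theta]=\sum_{\theta\in\Theta}\theta\,\pi(\theta)$ be the (prior) average parameter. For any $\theta_0$ and $\theta_1$ in $\Theta$, the inequality $\mathbb{E}_{\theta_1}[q^{\theta_0}]\leq\pi(\theta_0)$ holds if and only if $\overline{\theta}$ lies between $\theta_0$ and $\theta_1$ (i.e., $\min\{\theta_0,\theta_1\}\leq\overline\theta\leq\max\{\theta_0,\theta_1\}$), with equality if and only if $\overline{\theta}=\theta_0$ or $\overline{\theta}=\theta_1$.
   Context: $\Theta$ is finite and the prior satisfies $\pi(\theta)>0$ for every $\theta\in\Theta$. $\mathbb{P}_\theta(x=1)=\theta=1-\mathbb{P}_\theta(x=0)$, and $\mathbb{P}=\sum_{\theta\in\Theta}\pi(\theta)\mathbb{P}_\theta$ is the marginal probability. The posterior of $\theta_0$ given $x$ is $q^{\theta_0}(x)=\mathbb{P}(\theta_0\mid x)=\mathbb{P}_{\theta_0}(x)\pi(\theta_0)/\mathbb{P}(x)$ (defined when $\mathbb{P}(x)>0$), and $\mathbb{E}_{\theta_1}[q^{\theta_0}]=\sum_{x}\mathbb{P}_{\theta_1}(x)\,q^{\theta_0}(x)$, the sum over $x\in\{0,1\}$ with $\mathbb{P}(x)>0$. *)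

(* Defs.v *)
(* MathComp / MathComp-Analysis. *)
From mathcomp Require Import all_boot all_order all_algebra finmap.
From mathcomp Require Import reals bernoulli_distribution.

Set Implicit Arguments.
Unset Strict Implicit.
Unset Printing Implicit Defensive.

Import Order.TTheory GRing.Theory Num.Theory.
Local Open Scope ring_scope.

(* The observation x in {0, 1} is a boolean, with true for x = 1, so that
   P_theta(x) is [bernoulli_pmf theta x].  A prior on the finite set Theta is a
   function R -> R of which only the values on Theta are used. *)

Definition prior_mean (R : realType) (Theta : {fset R}) (prior : R -> R) : R :=
  \sum_(theta <- Theta) theta * prior theta.

Definition marginal (R : realType) (Theta : {fset R}) (prior : R -> R)
    (x : bool) : R :=
  \sum_(theta <- Theta) prior theta * bernoulli_pmf theta x.

(* Meaningful only when 0 < marginal Theta prior x (otherwise the quotient has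
   the conventional value 0, which [expected_posterior] never uses). *)
Definition posterior (R : realType) (Theta : {fset R}) (prior : R -> R)
    (theta0 : R) (x : bool) : R :=
  bernoulli_pmf theta0 x * prior theta0 / marginal Theta prior x.

(* E_theta1[q^theta0] *)
Definition expected_posterior (R : realType) (Theta : {fset R})
    (prior : R -> R) (theta1 theta0 : R) : R :=
  \sum_(x : bool | 0 < marginal Theta prior x)
    bernoulli_pmf theta1 x * posterior Theta prior theta0 x.

(* Main.v *)
Require Import Defs.
From mathcomp Require Import all_boot all_order all_algebra finmap.
From mathcomp Require Import reals bernoulli_distribution.
From mathcomp Require Import ring.

Set Implicit Arguments.
Unset Strict Implicit.
Unset Printing Implicit Defensive.

Import Order.TTheory GRing.Theory Num.Theory.
Local Open Scope ring_scope.

(** Write m for the prior mean and p0 for the prior mass of theta0.  Since the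
    Bernoulli mass function is affine in its parameter, the marginal law of the
    observation is Bernoulli(m).  When 0 < m < 1 both outcomes count, and the
    expected posterior exceeds p0 by p0 times
      theta0 theta1 / m + (1 - theta0) (1 - theta1) / (1 - m) - 1,
    which over the common denominator m (1 - m) has the numerator
    (m - theta0) (m - theta1) ([expected_posterior_excess]).  The
    sign of this product says whether m lies between theta0 and theta1, and its
    zeros give the equality case.

    When m is 0 or 1, it is an extreme point of the unit interval that contains
    Theta, and an average with positive weights reaches an extreme point only
    if every parameter equals it ([prior_mean_interior_or_degenerate]).  Then
    theta0 = theta1 = m, the outcome is deterministic, and the posterior is the
    prior ([expected_posterior_degenerate]), so that both equivalences hold
    between true statements. *)

Lemma marginal_bernoulli (R : realType) (Theta : {fset R}) (prior : R -> R)
    (x : bool) :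
  \sum_(theta <- Theta) prior theta = 1 ->
  marginal Theta prior x = bernoulli_pmf (prior_mean Theta prior) x.
Proof.
move=> prior1; rewrite /marginal /prior_mean /bernoulli_pmf; case: x.
  by apply: eq_bigr => theta _; rewrite mulrC.
rewrite -[in RHS]prior1 -sumrB.
by apply: eq_bigr => theta _; rewrite mulrBr mulr1 mulrC.
Qed.

(** The deviations from [c], weighted by the prior, add up to zero, so if they
    all have the same sign they all vanish.  That sign is carried by [s]: the
    lower endpoint is the case [s = 1], the upper one the case [s = -1]. *)
Lemma prior_mean_extreme (R : realType) (Theta : {fset R}) (prior : R -> R)
    (s c : R) :
  (forall theta, theta \in Theta -> 0 < prior theta) ->
  \sum_(theta <- Theta) prior theta = 1 ->
  s != 0 -> (forall theta, theta \in Theta -> 0 <= s * (theta - c)) ->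
  prior_mean Theta prior = c -> forall theta, theta \in Theta -> theta = c.
Proof.
move=> prior_gt0 prior1 s0 side mean_c theta theta_in.
have: \sum_(t <- Theta | t \in Theta) s * (t - c) * prior t == 0.
  rewrite -big_seq (eq_bigr (fun t => s * (t * prior t - c * prior t))).
    by rewrite -mulr_sumr sumrB -mulr_sumr prior1 -mean_c mulr1 subrr mulr0.
  by move=> t _; rewrite -mulrA mulrBl.
rewrite psumr_eq0; last first.
  by move=> t t_in; rewrite mulr_ge0 ?side // ltW ?prior_gt0.
move/allP/(_ theta theta_in); rewrite theta_in /=.
rewrite !mulf_eq0 (negPf s0) (gt_eqF (prior_gt0 _ theta_in)) orbF subr_eq0.
by move/eqP.
Qed.

Lemma prior_mean_interior_or_degenerate (R : realType) (Theta : {fset R})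
    (prior : R -> R) :
  (forall theta, theta \in Theta -> 0 <= theta <= 1) ->
  (forall theta, theta \in Theta -> 0 < prior theta) ->
  \sum_(theta <- Theta) prior theta = 1 ->
  0 < prior_mean Theta prior < 1 \/
  [/\ prior_mean Theta prior = 0 \/ prior_mean Theta prior = 1
    & forall theta, theta \in Theta -> theta = prior_mean Theta prior].
Proof.
move=> Theta01 prior_gt0 prior1; set m := prior_mean _ _.
have m_ge0 : 0 <= m.
  rewrite /m /prior_mean big_seq sumr_ge0 // => t t_in.
  by have /andP[t0 _] := Theta01 _ t_in; rewrite mulr_ge0 // ltW ?prior_gt0.
have m_le1 : m <= 1.
  rewrite -prior1 /m /prior_mean big_seq [leRHS]big_seq ler_sum // => t t_in.
  have /andP[_ t1] := Theta01 _ t_in.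
  by rewrite ler_piMl // ltW ?prior_gt0.
have [m0|m_neq0] := eqVneq m 0.
  right; split; first by left.
  rewrite m0; apply: (@prior_mean_extreme _ _ prior 1) => // [|t t_in].
    exact: oner_neq0.
  by rewrite mul1r subr0; case/andP: (Theta01 _ t_in).
have [m1|m_neq1] := eqVneq m 1.
  right; split; first by right.
  rewrite m1; apply: (@prior_mean_extreme _ _ prior (-1)) => // [|t t_in].
    by rewrite oppr_eq0 oner_neq0.
  by rewrite mulN1r opprB subr_ge0; case/andP: (Theta01 _ t_in).
by left; rewrite !lt_neqAle m_neq1 m_le1 m_ge0 eq_sym m_neq0.
Qed.

Lemma expected_posterior_excess (R : realType) (Theta : {fset R})
    (prior : R -> R) (theta0 theta1 : R) (m := prior_mean Theta prior) :
  \sum_(theta <- Theta) prior theta = 1 -> 0 < m < 1 ->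
  expected_posterior Theta prior theta1 theta0 - prior theta0 =
  prior theta0 / (m * (1 - m)) * ((m - theta0) * (m - theta1)).
Proof.
move=> prior1 /andP[m_gt0 m_lt1].
have m'_gt0 : 0 < 1 - m by rewrite subr_gt0.
rewrite /expected_posterior big_mkcond big_bool /posterior.
rewrite !marginal_bernoulli // -/m /bernoulli_pmf /= m_gt0 m'_gt0.
by field; rewrite !gt_eqF.
Qed.

Lemma expected_posterior_degenerate (R : realType) (Theta : {fset R})
    (prior : R -> R) (m := prior_mean Theta prior) :
  \sum_(theta <- Theta) prior theta = 1 -> m = 0 \/ m = 1 ->
  expected_posterior Theta prior m m = prior m.
Proof.
move=> prior1 m01.
rewrite /expected_posterior big_mkcond big_bool /posterior.
rewrite !marginal_bernoulli // -/m /bernoulli_pmf.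
case: m01 => ->; rewrite ?subr0 ?subrr ltxx ltr01 /=.
  by rewrite add0r divr1 !mul1r.
by rewrite addr0 divr1 !mul1r.
Qed.

Lemma between_mul_le0 (R : realDomainType) (a b m : R) :
  (Num.min a b <= m <= Num.max a b) = ((m - a) * (m - b) <= 0).
Proof.
rewrite ge_min le_max -[a <= m]subr_ge0 -[b <= m]subr_ge0.
rewrite -[m <= a]subr_le0 -[m <= b]subr_le0.
have [a_lt|a_gt|<-] := ltgtP 0 (m - a); last by rewrite mul0r lexx.
  by rewrite pmulr_rle0.
by rewrite nmulr_rle0 // andbT.
Qed.

Theorem proposition5 (R : realType) (Theta : {fset R}) (prior : R -> R)
    (Theta01 : forall theta, theta \in Theta -> 0 <= theta <= 1)
    (prior_gt0 : forall theta, theta \in Theta -> 0 < prior theta)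
    (prior_sum1 : \sum_(theta <- Theta) prior theta = 1)
    (theta0 theta1 : R) (theta0_in : theta0 \in Theta)
    (theta1_in : theta1 \in Theta) :
  (expected_posterior Theta prior theta1 theta0 <= prior theta0 <->
   Num.min theta0 theta1 <= prior_mean Theta prior <= Num.max theta0 theta1) /\
  (expected_posterior Theta prior theta1 theta0 = prior theta0 <->
   prior_mean Theta prior = theta0 \/ prior_mean Theta prior = theta1).
Proof.
have [m_in|[m01 all_m]] :=
  prior_mean_interior_or_degenerate Theta01 prior_gt0 prior_sum1.
  have excess := expected_posterior_excess theta0 theta1 prior_sum1 m_in.
  have factor_gt0 : 0 < prior theta0
      / (prior_mean Theta prior * (1 - prior_mean Theta prior)).
    case/andP: m_in => m_gt0 m_lt1.
    by rewrite divr_gt0 ?mulr_gt0 ?subr_gt0 ?prior_gt0.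
  split.
    by rewrite between_mul_le0 -subr_le0 excess pmulr_rle0.
  split=> [/eqP|mE].
    rewrite -subr_eq0 excess mulf_eq0 (gt_eqF factor_gt0) /= mulf_eq0 !subr_eq0.
    by case/orP => /eqP ?; [left|right].
  apply/eqP; rewrite -subr_eq0 excess.
  by case: mE => ->; rewrite subrr ?mul0r !mulr0.
rewrite (all_m _ theta0_in) (all_m _ theta1_in).
rewrite expected_posterior_degenerate // minxx maxxx !lexx.
by split; split => // _; left.
Qed.
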